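(* Let $A\in GL_n(\mathbf{R})$, with discretization $\widehat A:\mathbf{Z}^n\to\mathbf{Z}^n$. (1) If $\Gamma\subset\mathbf{Z}^n$ is an almost periodic pattern, then $\widehat A(\Gamma)$ is an almost periodic pattern. (2) If $\Gamma\subset\mathbf{Z}^n$ is a model set, then $\widehat A(\Gamma)$ is a model set.
   Context: Fix an integer $n\ge 1$. Balls are taken with respect to the sup norm: $B(x,R)=\{y\in\mathbf{R}^n : |x_i-y_i|<R \text{ for all } i\}$, and $B_R=B(0,R)$. $\Delta$ denotes symmetric difference. Discretization: for $x\in\mathbf{R}$, $P(x)$ is the unique integer $k$ with $k-1/2<x\le k+1/2$; $\pi:\mathbf{R}^n\to\mathbf{Z}^n$ is $\pi(x_1,\dots,x_n)=(P(x_1),\dots,P(x_n))$. For a real $n\times n$ matrix $A$, $\widehat A:\mathbf{Z}^n\to\mathbf{Z}^n$ is $\widehat A(x)=\pi(Ax)$. Model set: let $m\ge 1$, let $\Lambda$ be a lattice of $\mathbf{R}^{m+n}$, let $p_1,p_2$ be the projections of $\mathbf{R}^{m+n}=\mathbf{R}^m\times\mathbf{R}^n$ onto $\mathbf{R}^m\times\{0\}\cong\mathbf{R}^m$ and $\{0\}\times\mathbf{R}^n\cong\mathbf{R}^n$ respectively, and let $W\subset\mathbf{R}^m$ be measurable. The model set modelled on $\Lambda$ and the window $W$ is $\{p_2(\lambda) : \lambda\in\Lambda,\ p_1(\lambda)\in W\}\subset\mathbf{R}^n$ (no injectivity of $p_1$ or $p_2$ on $\Lambda$ is assumed). A subset of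 $\mathbf{R}^n$ is a model set if it is of this form for some $m$, $\Lambda$, $W$. Delone set: $\Gamma\subset\mathbf{R}^n$ is relatively dense if there is $R_\Gamma>0$ such that each ball of radius at least $R_\Gamma$ contains at least one point of $\Gamma$; uniformly discrete if there is $r_\Gamma>0$ such that each ball of radius at most $r_\Gamma$ contains at most one point of $\Gamma$; Delone if both. For $R>0$ and $E\subset\mathbf{R}^n$, $D_R^+(E)=\sup_{x\in\mathbf{R}^n}\frac{\mathrm{Card}(E\cap B(x,R))}{\mathrm{Vol}(B_R)}$. An almost periodic pattern is a Delone set $\Gamma\subset\mathbf{R}^n$ such that for every $\varepsilon>0$ there exists $R_\varepsilon>0$ for which the set $\{v\in\mathbf{R}^n : \forall R\ge R_\varepsilon,\ D_R^+((\Gamma+v)\Delta\Gamma)<\varepsilon\}$ is relatively dense. *)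

(* Defs.v *)
From HB Require Import structures.
From mathcomp Require Import all_boot all_order all_algebra.
From mathcomp Require Import all_classical all_reals all_analysis.
From mathcomp Require Import lra.

Set Implicit Arguments.
Unset Strict Implicit.
Unset Printing Implicit Defensive.

Import Order.TTheory GRing.Theory Num.Theory.
Import numFieldNormedType.Exports.

Local Open Scope classical_set_scope.
Local Open Scope ring_scope.

(* Points of R^n are column vectors; [ball] on 'cV[R]_n is the open ball of the
   sup norm, empty when the radius is not positive. *)
Lemma ball_cVP (R : realType) (n : nat) (x y : 'cV[R]_n) (r : R) :
  ball x r y <-> 0 < r /\ forall i, `|x i ord0 - y i ord0| < r.
Proof.
split=> -[r0 H]; split=> //.
  by move=> i; exact: H.
by move=> i j; rewrite (ord1 j); exact: H.
Qed.

Definition intcv (R : realType) (n : nat) (z : 'cV[int]_n) : 'cV[R]_n :=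
  map_mx intr z.
Arguments intcv R {n} z.

(* Rounding to the nearest integer, halves being rounded down. *)
Definition round (R : realType) (x : R) : int := Num.ceil (x - 2^-1).

Lemma roundP (R : realType) (x : R) (k : int) :
  round x = k <-> k%:~R - 2^-1 < x <= k%:~R + 2^-1.
Proof.
rewrite /round; split=> [<-|/andP[lkx lxk]].
  have /andP[] := ceil_itv (x - 2^-1); rewrite intrB.
  by move=> h1 h2; apply/andP; split; lra.
by apply: ceil_def; rewrite intrB; apply/andP; split; lra.
Qed.

Definition discretization (R : realType) (n : nat) (A : 'M[R]_n)
    (z : 'cV[int]_n) : 'cV[int]_n :=
  map_mx (@round R) (A *m intcv R z).

(* The boxes ]a, b], empty and of volume 0 as soon as b_i <= a_i for some i. *)
Definition box (R : realType) (n : nat) (a b : 'cV[R]_n) : set 'cV[R]_n :=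
  [set x | forall i, a i ord0 < x i ord0 <= b i ord0].

Definition box_volume (R : realType) (n : nat) (a b : 'cV[R]_n) : R :=
  \prod_(i < n) Num.max 0 (b i ord0 - a i ord0).

Definition lebesgue_outer_measure (R : realType) (n : nat)
    (X : set 'cV[R]_n) : \bar R :=
  ereal_inf [set (\sum_(0 <= k <oo) (box_volume (F k).1 (F k).2)%:E)%E |
    F in [set F : nat -> 'cV[R]_n * 'cV[R]_n |
      X `<=` \bigcup_k box (F k).1 (F k).2]].

Definition lebesgue_measurable (R : realType) (n : nat) (X : set 'cV[R]_n) :
    Prop :=
  caratheodory_measurable (@lebesgue_outer_measure R n) X.

(* The Z-span of a basis of R^n, given by the columns of B. *)
Definition is_lattice (R : realType) (n : nat) (L : set 'cV[R]_n) : Prop :=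
  exists2 B : 'M[R]_n, B \in unitmx & L = range (fun z => B *m intcv R z).

Definition model_set_on (R : realType) (m n : nat) (L : set 'cV[R]_(m + n))
    (W : set 'cV[R]_m) : set 'cV[R]_n :=
  [set dsubmx l | l in L `&` [set l | W (usubmx l)]].

Definition is_model_set (R : realType) (n : nat) (G : set 'cV[R]_n) : Prop :=
  exists m : nat, (0 < m)%N /\
  exists (L : set 'cV[R]_(m + n)) (W : set 'cV[R]_m),
    [/\ is_lattice L, lebesgue_measurable W & G = model_set_on L W].

Definition relatively_dense (R : realType) (n : nat) (G : set 'cV[R]_n) :
    Prop :=
  exists2 rG : R, 0 < rG & forall (x : 'cV[R]_n) (r : R), rG <= r ->
    G `&` ball x r !=set0.

Definition uniformly_discrete (R : realType) (n : nat) (G : set 'cV[R]_n) :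
    Prop :=
  exists2 rG : R, 0 < rG & forall (x : 'cV[R]_n) (r : R), 0 < r -> r <= rG ->
    is_subset1 (G `&` ball x r).

Definition delone (R : realType) (n : nat) (G : set 'cV[R]_n) : Prop :=
  relatively_dense G /\ uniformly_discrete G.

(* The ball of radius r about 0 is, up to its boundary, the box ]-r, r]^n. *)
Definition ball_volume (R : realType) (n : nat) (r : R) : R :=
  @box_volume R n (const_mx (- r)) (const_mx r).

Lemma ball_volumeE (R : realType) (n : nat) (r : R) : 0 < r ->
  ball_volume n r = (2 * r) ^+ n.
Proof.
move=> r0; rewrite /ball_volume /box_volume.
under eq_bigr do rewrite !mxE max_r ?opprK ?addr_ge0 ?ltW // -mulr2n -mulr_natl.
by rewrite prodr_const card_ord.
Qed.

Definition uniform_upper_density (R : realType) (n : nat) (r : R)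
    (E : set 'cV[R]_n) : \bar R :=
  ereal_sup
    (range (fun x => counting (E `&` ball x r) / (ball_volume n r)%:E)%E).

Definition translate (R : realType) (n : nat) (G : set 'cV[R]_n)
    (v : 'cV[R]_n) : set 'cV[R]_n :=
  [set x + v | x in G].

Definition almost_periodic_pattern (R : realType) (n : nat)
    (G : set 'cV[R]_n) : Prop :=
  delone G /\
  forall e : R, 0 < e -> exists2 re : R, 0 < re &
    relatively_dense [set v | forall r : R, re <= r ->
      (uniform_upper_density r (translate G v `+` G) < e%:E)%E].

(* Main.v *)
(* Model sets: [z] is the discretization of [p2 l], [l] in the lattice, iff
   [A p2 l - z] lies in the half-open unit cube. So the image is cut out of the
   lattice of all [(p1 l, A p2 l - z, z)], [z] an integer vector, by the window
   [W] times the cube; this window is measurable because Caratheodory's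
   criterion can be tested on boxes.

   Almost periodic patterns: if [v] is an almost period of [G] and [A v] is
   within a small [t] of an integer vector [w], then rounding [A (x + v)] gives
   the rounding of [A x] plus [w], except at the points [x] where adding a
   coordinate of [t] flips the rounding. These have small density, so [w] is an
   almost period of the image. By pigeonhole, differences of almost periods
   provide a relatively dense set of such [w]. *)
Require Import Defs.
From HB Require Import structures.
From mathcomp Require Import all_boot all_order all_algebra.
From mathcomp Require Import all_classical all_reals all_analysis.
From mathcomp Require Import lra.

Set Implicit Arguments.
Unset Strict Implicit.
Unset Printing Implicit Defensive.

Import Order.TTheory GRing.Theory Num.Theory.
Import numFieldNormedType.Exports.

Local Open Scope classical_set_scope.
Local Open Scope ring_scope.

(** * Boxes and the Lebesgue outer measure *)

Lemma box_volume_ge0 (R : realType) (n : nat) (a b : 'cV[R]_n) :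
  0 <= box_volume a b.
Proof. by apply: prodr_ge0 => i _; rewrite le_max lexx. Qed.

Lemma box_volume_eq0 (R : realType) (n : nat) (a b : 'cV[R]_n) i :
  b i ord0 <= a i ord0 -> box_volume a b = 0.
Proof.
move=> ba; rewrite /box_volume (bigD1 i)//= max_l ?mul0r//.
by rewrite subr_le0.
Qed.

Lemma box_volume_split (R : realType) (m n : nat) (a b : 'cV[R]_(m + n)) :
  box_volume a b = box_volume (dsubmx a) (dsubmx b) *
                   box_volume (usubmx a) (usubmx b).
Proof.
rewrite /box_volume big_split_ord mulrC/=.
by congr (_ * _); apply: eq_bigr => i _; rewrite !mxE.
Qed.

Lemma box_split (R : realType) (m n : nat) (a b : 'cV[R]_(m + n)) x :
  box a b x <-> box (usubmx a) (usubmx b) (usubmx x) /\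
                box (dsubmx a) (dsubmx b) (dsubmx x).
Proof.
split=> [H|[Hu Hd] i].
  by split=> i; rewrite !mxE; exact: H.
rewrite -(splitK i); case: (fintype.split i) => j /=.
  by have := Hu j; rewrite !mxE.
by have := Hd j; rewrite !mxE.
Qed.

Lemma lebesgue_outer_measure_le_cover (R : realType) (n : nat)
    (X : set 'cV[R]_n) (F : nat -> 'cV[R]_n * 'cV[R]_n) :
  X `<=` \bigcup_k box (F k).1 (F k).2 ->
  (lebesgue_outer_measure X <=
     \sum_(0 <= k <oo) (box_volume (F k).1 (F k).2)%:E)%E.
Proof. by move=> XF; apply: ereal_inf_lbound; exists F. Qed.

Lemma lebesgue_outer_measure_ge0 (R : realType) (n : nat)
    (X : set 'cV[R]_n) : (0 <= lebesgue_outer_measure X)%E.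
Proof.
apply: le_ereal_inf_tmp => _ [F _ <-].
by apply: nneseries_ge0 => k _ _; rewrite lee_fin box_volume_ge0.
Qed.

Lemma le_lebesgue_outer_measure (R : realType) (n : nat) :
  {homo @lebesgue_outer_measure R n : X Y / X `<=` Y >-> (X <= Y)%E}.
Proof.
move=> X Y XY; apply: le_ereal_inf_tmp => _ [F YF <-].
by apply: lebesgue_outer_measure_le_cover; exact: subset_trans YF.
Qed.

Lemma lebesgue_outer_measure_box (R : realType) (n : nat) (a b : 'cV[R]_n) :
  (0 < n)%N ->
  (lebesgue_outer_measure (box a b) <= (box_volume a b)%:E)%E.
Proof.
case: n a b => // n a b _.
(* The cover is padded with degenerate boxes, of volume 0 because the dimension is positive. *)
pose F (k : nat) : 'cV[R]_n.+1 * 'cV[R]_n.+1 :=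
  if k is 0%N then (a, b) else (0, 0).
apply: (le_trans (@lebesgue_outer_measure_le_cover _ _ _ F _)).
  by move=> x xab; exists 0%N.
rewrite nneseries_recl//; last by move=> k _; rewrite lee_fin box_volume_ge0.
rewrite eseries_cond/= eseries0 ?adde0//.
by case=> [|k] //= _ _; rewrite (@box_volume_eq0 _ _ _ _ ord0)// !mxE.
Qed.

Lemma lebesgue_outer_measure0 (R : realType) (n : nat) :
  lebesgue_outer_measure (set0 : set 'cV[R]_n.+1) = 0%E.
Proof.
apply/eqP; rewrite eq_le lebesgue_outer_measure_ge0 andbT.
have v0 : (0 : \bar R)%E = (box_volume (0 : 'cV[R]_n.+1) 0)%:E.
  by rewrite (@box_volume_eq0 _ _ _ _ ord0).
rewrite [leRHS]v0; apply: le_trans (lebesgue_outer_measure_box _ _ _) => //.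
exact: le_lebesgue_outer_measure.
Qed.

Lemma lebesgue_outer_measure_adherent (R : realType) (n : nat)
    (X : set 'cV[R]_n) (e : R) : 0 < e ->
    lebesgue_outer_measure X \is a fin_num ->
  exists2 F : nat -> 'cV[R]_n * 'cV[R]_n,
    X `<=` \bigcup_k box (F k).1 (F k).2 &
    (\sum_(0 <= k <oo) (box_volume (F k).1 (F k).2)%:E <=
       lebesgue_outer_measure X + e%:E)%E.
Proof.
by move=> e0 /(lb_ereal_inf_adherent e0)[_ [F XF <-] /ltW]; exists F.
Qed.

(** Each [A i] gets a cover exceeding its measure by at most e / 2^(i+1); a bijection of [nat] with
    [nat * nat] merges these covers into one sequence. *)
Lemma lebesgue_outer_measure_sigma_subadditive (R : realType) (n : nat) :
  sigma_subadditive (@lebesgue_outer_measure R n).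
Proof.
move=> A; have [[i ioo]|Aoo] :=
  pselect (exists i, lebesgue_outer_measure (A i) = +oo%E).
  rewrite (eseries_pinfty _ _ ioo) ?leey// => k _.
  by rewrite -ltNye (lt_le_trans _ (lebesgue_outer_measure_ge0 _)).
have Afin i : lebesgue_outer_measure (A i) \is a fin_num.
  rewrite ge0_fin_numE ?lebesgue_outer_measure_ge0//.
  by rewrite ltey; apply/eqP => Ai; apply: Aoo; exists i.
apply/lee_addgt0Pr => e e0.
apply: le_trans (epsilon_trick _ _ (ltW e0)); last first.
  by move=> i; exact: lebesgue_outer_measure_ge0.
pose P i (F : nat -> 'cV[R]_n * 'cV[R]_n) :=
  A i `<=` \bigcup_k box (F k).1 (F k).2 /\
  (\sum_(0 <= k <oo) (box_volume (F k).1 (F k).2)%:E <=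
     lebesgue_outer_measure (A i) + (e / (2 ^ i.+1)%:R)%:E)%E.
have [G PG] : {G & forall i, P i (G i)}.
  apply: (@choice _ _ P) => i.
  have ei : 0 < e / (2 ^ i.+1)%:R by rewrite divr_gt0// ltr0n expn_gt0.
  by have [F AF vF] := lebesgue_outer_measure_adherent ei (Afin i); exists F.
pose v (ij : nat * nat) := (box_volume (G ij.1 ij.2).1 (G ij.1 ij.2).2)%:E.
have v0 ij : (0 <= v ij)%E by rewrite lee_fin box_volume_ge0.
apply: (@le_trans _ _ (\sum_(i <oo) \sum_(j <oo) v (i, j))%E); last first.
  apply: lee_nneseries => i *; last exact: (PG i).2.
  by apply: nneseries_ge0 => j _ _; exact: v0.
have /card_esym/ppcard_eqP[f] := card_nat2.
have -> : (\sum_(i <oo) \sum_(j <oo) v (i, j) =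
           \sum_(k <oo) v (f k))%E.
  rewrite [RHS]nneseries_esumT//.
  rewrite -(reindex_esum [set: nat] [set: nat * nat] f v)//.
  rewrite nneseries_esumT; last by move=> i; exact: nneseries_ge0.
  under eq_esum do rewrite nneseries_esumT//.
  rewrite esum_esum//; congr esum.
  by apply/seteqP; split=> -[].
apply: (@lebesgue_outer_measure_le_cover _ _ _ (fun k => G (f k).1 (f k).2)).
move=> x [i _] /(PG i).1[j _ xij]; exists (f^-1%FUN (i, j)) => //=.
by rewrite invK ?inE.
Qed.

(** Gives access to the general Caratheodory theory. In dimension 0 every box has volume 1, so the
    empty set would not have outer measure 0. *)
HB.instance Definition _ (R : realType) (n : nat) :=
  isOuterMeasure.Build R 'cV[R]_n.+1 (@lebesgue_outer_measure R n.+1)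
    (lebesgue_outer_measure0 R n) (@lebesgue_outer_measure_ge0 R n.+1)
    (@le_lebesgue_outer_measure R n.+1)
    (@lebesgue_outer_measure_sigma_subadditive R n.+1).

(** * Caratheodory measurability of windows *)

(** Given a cover of a test set by boxes, subadditivity bounds the two pieces by sums over the
    boxes, where the hypothesis applies term by term. *)
Lemma lebesgue_measurable_box_test (R : realType) (n : nat)
    (S : set 'cV[R]_n) : (0 < n)%N ->
  (forall a b, lebesgue_outer_measure (box a b `&` S) +
     lebesgue_outer_measure (box a b `&` ~` S) <= (box_volume a b)%:E)%E ->
  lebesgue_measurable S.
Proof.
case: n S => // n S _ Sbox.
apply: (@le_caratheodory_measurable R _ (@lebesgue_outer_measure R n.+1)) => X.
apply: le_ereal_inf_tmp => _ [F XF <-].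
have sub (T : set 'cV[R]_n.+1) : (lebesgue_outer_measure (X `&` T) <=
    \sum_(k <oo) lebesgue_outer_measure (box (F k).1 (F k).2 `&` T))%E.
  apply: le_trans (lebesgue_outer_measure_sigma_subadditive _).
  apply: le_lebesgue_outer_measure => x [/XF[k _ Fkx] Tx].
  by exists k.
apply: le_trans (leeD (sub S) (sub (~` S))) _.
rewrite -nneseriesD; [|by move=> *; exact: lebesgue_outer_measure_ge0..].
apply: lee_nneseries => k *; last exact: Sbox.
by apply: adde_ge0; exact: lebesgue_outer_measure_ge0.
Qed.

Lemma lebesgue_measurableC (R : realType) (n : nat) (S : set 'cV[R]_n) :
  lebesgue_measurable S -> lebesgue_measurable (~` S).
Proof. by move=> mS X; rewrite setCK addeC -mS. Qed.

Lemma lebesgue_measurableI (R : realType) (n : nat) (S T : set 'cV[R]_n) :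
    (0 < n)%N -> lebesgue_measurable S -> lebesgue_measurable T ->
  lebesgue_measurable (S `&` T).
Proof.
case: n S T => // n S T _.
exact: (@caratheodory_measurable_setI _ _ (@lebesgue_outer_measure R n.+1)).
Qed.

Lemma lebesgue_measurable_forall (R : realType) (n : nat) (I : finType)
    (S : I -> set 'cV[R]_n) : (0 < n)%N ->
    (forall i, lebesgue_measurable (S i)) ->
  lebesgue_measurable [set x | forall i, S i x].
Proof.
move=> n0 mS; have -> : [set x | forall i, S i x] =
    \big[setI/setT]_(i : I) S i.
  rewrite -bigcap_seq; apply/seteqP; split=> x /= H i //.
  by apply: H; rewrite /= mem_index_enum.
elim/big_ind: _ => [|A B|i _]; last exact: mS.
- rewrite -setC0; apply: lebesgue_measurableC; case: n n0 S {mS} => // n _ _.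
  exact: (@caratheodory_measurable_set0 _ _ (@lebesgue_outer_measure R n.+1)).
- exact: lebesgue_measurableI.
Qed.

(** Multiplying each box of a cover of [V] by [box c d] gives a cover of the product. *)
Lemma lebesgue_outer_measure_prod_le (R : realType) (m n : nat)
    (V : set 'cV[R]_m) (c d : 'cV[R]_n) :
    lebesgue_outer_measure V \is a fin_num ->
  (lebesgue_outer_measure
     [set x : 'cV[R]_(m + n) | V (usubmx x) /\ box c d (dsubmx x)] <=
   (box_volume c d)%:E * lebesgue_outer_measure V)%E.
Proof.
move=> Vfin; apply/lee_addgt0Pr => e e0; set v := box_volume c d.
have v0 : 0 <= v := box_volume_ge0 c d.
(* Dividing by [v + 1] keeps the tolerance positive when [v] is 0. *)
have [|F VF vF] := @lebesgue_outer_measure_adherent _ _ V (e / (v + 1)) _ Vfin.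
  by rewrite divr_gt0// ltr_wpDl.
pose F' k := (col_mx (F k).1 c, col_mx (F k).2 d).
apply: (le_trans (@lebesgue_outer_measure_le_cover _ _ _ F' _)).
  move=> x /= [/VF[k _ xk] xcd]; exists k => //=.
  by apply/box_split; rewrite !col_mxKu !col_mxKd.
under eq_eseriesr do rewrite box_volume_split !col_mxKu !col_mxKd EFinM.
rewrite nneseriesZl; last by move=> k _; rewrite lee_fin box_volume_ge0.
apply: (@le_trans _ _ (v%:E * (lebesgue_outer_measure V + (e / (v + 1))%:E)))%E.
  by rewrite lee_wpmul2l ?lee_fin.
rewrite -(fineK Vfin) -EFinD -!EFinM -EFinD lee_fin mulrDr lerD2l.
by rewrite mulrCA ler_piMr ?(ltW e0)// ler_pdivrMr ?mul1r ?lerDl// ltr_wpDl.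
Qed.

(** A box meets the cylinder over [W] in a product. The product bounds for [W] and its complement
    add up, by measurability of [W], to [v] times the outer measure of [I]. *)
Lemma lebesgue_measurable_cylinder (R : realType) (m n : nat)
    (W : set 'cV[R]_m) : (0 < m)%N -> lebesgue_measurable W ->
  lebesgue_measurable [set x : 'cV[R]_(m + n) | W (usubmx x)].
Proof.
move=> m0 mW; apply: lebesgue_measurable_box_test => [|a b].
  by rewrite addn_gt0 m0.
set I := box (usubmx a) (usubmx b); set v := box_volume (dsubmx a) (dsubmx b).
have leI := lebesgue_outer_measure_box (usubmx a) (usubmx b) m0.
have fin (T : set 'cV[R]_m) : lebesgue_outer_measure (I `&` T) \is a fin_num.
  rewrite ge0_fin_numE ?lebesgue_outer_measure_ge0//.
  apply: (@le_lt_trans _ _ (lebesgue_outer_measure I)).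
    by apply: le_lebesgue_outer_measure; exact: subIsetl.
  exact: le_lt_trans leI (ltry _).
have sub (T : set 'cV[R]_m) :
    (lebesgue_outer_measure (box a b `&` [set x | T (usubmx x)]) <=
     v%:E * lebesgue_outer_measure (I `&` T))%E.
  apply: le_trans (lebesgue_outer_measure_prod_le _ _ (fin T)).
  apply: le_lebesgue_outer_measure => x /= [/box_split[xu xd] Tx].
  by split.
apply: le_trans (leeD (sub W) (sub (~` W))) _.
rewrite -ge0_muleDr ?lebesgue_outer_measure_ge0// -mW.
by rewrite box_volume_split EFinM lee_wpmul2l ?lee_fin ?box_volume_ge0.
Qed.

(** The half-space and its complement cut a box into parts of two boxes that differ from it only in
    direction [i], where the side lengths add up. *)
Lemma lebesgue_measurable_gt (R : realType) (n : nat) (i : 'I_n) (c : R) :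
  lebesgue_measurable [set x : 'cV[R]_n | c < x i ord0].
Proof.
case: n i => [[]//|n] i.
apply: lebesgue_measurable_box_test => // a b.
pose a' : 'cV[R]_n.+1 :=
  \col_j if j == i then Num.max (a j ord0) c else a j ord0.
pose b' : 'cV[R]_n.+1 :=
  \col_j if j == i then Num.min (b j ord0) c else b j ord0.
have suba : box a b `&` [set x | c < x i ord0] `<=` box a' b.
  move=> x [xab /= cx] j; rewrite mxE; have := xab j.
  by case: eqP => // ->; rewrite gt_max cx andbT.
have subb : box a b `&` ~` [set x | c < x i ord0] `<=` box a b'.
  move=> x [xab /= /negP]; rewrite -leNgt => cx j; rewrite mxE; have := xab j.
  by case: eqP => // ->; rewrite le_min cx andbT.
apply: le_trans (leeD (le_lebesgue_outer_measure suba)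
  (le_lebesgue_outer_measure subb)) _.
apply: le_trans (leeD (lebesgue_outer_measure_box _ _ _)
  (lebesgue_outer_measure_box _ _ _)) _ => //.
rewrite -EFinD lee_fin /box_volume (bigD1 i)//= [X in _ + X](bigD1 i)//=.
rewrite [X in _ <= X](bigD1 i)//= !mxE eqxx.
rewrite (eq_bigr (fun j => Num.max 0 (b j ord0 - a j ord0))); last first.
  by move=> j /negbTE ji; rewrite mxE ji.
rewrite [X in _ + _ * X](eq_bigr (fun j => Num.max 0 (b j ord0 - a j ord0)));
  last first.
  by move=> j /negbTE ji; rewrite mxE ji.
rewrite -mulrDl ler_wpM2r//.
  by apply: prodr_ge0 => j _; rewrite le_max lexx.
rewrite /Num.max /Num.min; repeat case: ifPn; rewrite -?leNgt; lra.
Qed.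

Lemma lebesgue_measurable_slab (R : realType) (n : nat) (i : 'I_n) (c d : R) :
  lebesgue_measurable [set x : 'cV[R]_n | c < x i ord0 <= d].
Proof.
have -> : [set x : 'cV[R]_n | c < x i ord0 <= d] =
    [set x | c < x i ord0] `&` ~` [set x | d < x i ord0].
  apply/seteqP; split=> x /=.
    by move=> /andP[-> xd]; split=> //; apply/negP; rewrite -leNgt.
  by move=> [-> /negP]; rewrite -leNgt.
apply: lebesgue_measurableI; first exact: leq_ltn_trans (ltn_ord i).
  exact: lebesgue_measurable_gt.
by apply: lebesgue_measurableC; exact: lebesgue_measurable_gt.
Qed.

Lemma lebesgue_measurable_window (R : realType) (m n : nat)
    (W : set 'cV[R]_m) (c d : R) : (0 < m)%N -> lebesgue_measurable W ->
  lebesgue_measurable [set x : 'cV[R]_(m + n) |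
    W (usubmx x) /\ forall i, c < x (rshift m i) ord0 <= d].
Proof.
move=> m0 mW; have mn0 : (0 < m + n)%N by rewrite addn_gt0 m0.
apply: (@lebesgue_measurableI _ _ [set x | W (usubmx x)]
  [set x | forall i, c < x (rshift m i) ord0 <= d]) => //.
  exact: lebesgue_measurable_cylinder.
by apply: lebesgue_measurable_forall => // i; exact: lebesgue_measurable_slab.
Qed.

(** * Discretization of model sets *)

Lemma intcv_col (R : realType) (m n : nat) (x : 'cV[int]_m) (y : 'cV[int]_n) :
  intcv R (col_mx x y) = col_mx (intcv R x) (intcv R y).
Proof. exact: map_col_mx. Qed.

Lemma discretizationP (R : realType) (n : nat) (A : 'M[R]_n)
    (x y : 'cV[int]_n) :
  discretization A x = y <->
  forall i, - 2^-1 < (A *m intcv R x - intcv R y) i ord0 <= 2^-1.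
Proof.
split=> [<- i|H].
  have : round ((A *m intcv R x) i ord0) = discretization A x i ord0.
    by rewrite [RHS]mxE.
  move=> /roundP/andP[h1 h2]; rewrite !mxE in h1 h2 *.
  by apply/andP; split; lra.
apply/colP => i; rewrite mxE; apply/roundP.
by have /andP[] := H i; rewrite !mxE => ? ?; apply/andP; split; lra.
Qed.

Lemma model_set_discretization (R : realType) (n : nat) (A : 'M[R]_n)
    (G : set 'cV[int]_n) : A \in unitmx ->
  is_model_set (intcv R @` G) ->
  is_model_set (intcv R @` (discretization A @` G)).
Proof.
move=> uA [m [m0 [L [W [[B uB ->] mW GE]]]]].
exists (m + n)%N; split; first by rewrite addn_gt0 m0.
(* [T] keeps the [p1] coordinates and applies [A] to the [p2] coordinates. *)
pose T : 'M[R]_(m + n) := block_mx 1%:M 0 0 A.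
(* The first columns span the image of the lattice under [T]; the last ones add the vectors (0, -z,
   z) for integer z. *)
pose C : 'M[R]_(m + n + n) :=
  block_mx (T *m B) (col_mx 0 (- 1%:M)) 0 1%:M.
have CE z : C *m intcv R z = col_mx
    (T *m (B *m intcv R (usubmx z)) - col_mx 0 (intcv R (dsubmx z)))
    (intcv R (dsubmx z)).
  rewrite -{1}(vsubmxK z) intcv_col mul_block_col mul0mx mul1mx add0r.
  by rewrite [col_mx 0 _ *m _]mul_col_mx mul0mx mulNmx mul1mx mulmxA opp_col_mx
    oppr0.
have TE l : T *m l = col_mx (usubmx l) (A *m dsubmx l).
  by rewrite -{1}(vsubmxK l) mul_block_col !mul0mx mul1mx addr0 add0r.
exists (range (fun z => C *m intcv R z)), [set x : 'cV[R]_(m + n) |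
  W (usubmx x) /\ forall i, - 2^-1 < x (rshift m i) ord0 <= 2^-1].
split; [exists C => //|exact: lebesgue_measurable_window|].
  (* [C] is block triangular, so its determinant is det A times det B. *)
  rewrite unitmxE det_ublock det1 mulr1 det_mulmx det_ublock det1 mul1r.
  by rewrite unitrM -!unitmxE uA uB.
apply/seteqP; split.
- move=> _ [_ [x Gx <-] <-].
  have [_ [[z _ <-] /= Wz] zx] : model_set_on
      (range (fun z => B *m intcv R z)) W (intcv R x) by rewrite -GE; exists x.
  exists (C *m intcv R (col_mx z (discretization A x))); last first.
    by rewrite CE !col_mxKd.
  split; first by exists (col_mx z (discretization A x)).
  rewrite /= CE !col_mxKu col_mxKd TE zx opp_col_mx add_col_mx col_mxKu.
  split; first by rewrite oppr0 addr0.
  by move=> i; rewrite col_mxEd; exact: (discretizationP _ _ _).1.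
- move=> y [_ [[z _ <-] /= []]].
  rewrite CE col_mxKu col_mxKd TE opp_col_mx add_col_mx col_mxKu oppr0 addr0.
  move=> Wz Hz <-.
  (* The condition on [W] makes the [p2] part a point of [G]; the cube condition then identifies its
     discretization. *)
  have [x Gx xE] : (intcv R @` G) (dsubmx (B *m intcv R (usubmx z))).
    by rewrite GE; exists (B *m intcv R (usubmx z)) => //; split => //;
      exists (usubmx z).
  exists (discretization A x); first by exists x.
  congr intcv; apply/discretizationP => i.
  by have := Hz i; rewrite col_mxEd -xE.
Qed.

(** * Counting points and bounding densities *)

(** The list may have repetitions, so unions and images are just concatenation and map; [at_mostP]
    returns to [counting]. *)
Definition at_most (R : realType) (T : eqType) (X : set T) (c : R) : Prop :=
  exists2 s : seq T, X `<=` [set` s] & (size s)%:R <= c.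

Lemma at_mostW (R : realType) (T : eqType) (X Y : set T) (c d : R) :
  X `<=` Y -> c <= d -> at_most Y c -> at_most X d.
Proof.
move=> XY cd [s Ys sc].
by exists s; [exact: subset_trans Ys|exact: le_trans cd].
Qed.

Lemma at_most0 (R : realType) (T : eqType) (c : R) :
  0 <= c -> at_most (set0 : set T) c.
Proof. by exists [::]. Qed.

Lemma at_mostU (R : realType) (T : eqType) (X Y : set T) (c d : R) :
  at_most X c -> at_most Y d -> at_most (X `|` Y) (c + d).
Proof.
move=> [s Xs sc] [t Yt td]; exists (s ++ t).
  by move=> x /= [/Xs|/Yt] /= xst; rewrite mem_cat xst ?orbT.
by rewrite size_cat natrD lerD.
Qed.

Lemma at_most_image (R : realType) (T U : eqType) (f : T -> U) (X : set T)
    (c : R) : at_most X c -> at_most (f @` X) c.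
Proof.
move=> [s Xs sc]; exists [seq f x | x <- s]; last by rewrite size_map.
by move=> _ [x /Xs xs <-]; exact: map_f.
Qed.

(** The list [s] is pulled back along [g], a partial inverse of [f] on [X]. *)
Lemma at_most_inj (R : realType) (T U : eqType) (f : T -> U) (X : set T)
    (s : seq U) : (forall x y, X x -> X y -> f x = f y -> x = y) ->
  (forall x, X x -> f x \in s) -> at_most X ((size s)%:R : R).
Proof.
move=> fI fs; pose g u : option T :=
  if pselect (exists x, X x /\ f x = u) is left h then Some (projT1 (cid h))
  else None.
have gf x : X x -> g (f x) = Some x.
  move=> Xx; rewrite /g; case: pselect => [h|[]]; last by exists x.
  by case: cid => y /= [Xy fyx]; congr Some; exact: fI.
exists (pmap g s); last by rewrite ler_nat size_pmap count_size.
by move=> x Xx; rewrite /= mem_pmap; apply/mapP; exists (f x); rewrite ?gf ?fs.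
Qed.

Lemma at_most_preimage (R : realType) (T U : eqType) (f : T -> U) (X : set T)
    (c : R) : injective f -> at_most (f @` X) c -> at_most X c.
Proof.
move=> fI [s Xs sc]; apply: (@at_mostW _ _ X X (size s)%:R) => //.
apply: (@at_most_inj _ _ _ f) => [x y _ _ /fI//|x Xx].
by apply: Xs; exists x.
Qed.

Lemma at_mostP (R : realType) (T : choiceType) (X : set T) (c : R) :
  at_most X c <-> (counting X <= c%:E)%E.
Proof.
rewrite /counting; split=> [[s Xs sc]|].
  have fX : finite_set X.
    by apply: sub_finite_set Xs _; exact: finite_seq.
  rewrite asboolT// lee_fin (le_trans _ sc)// ler_nat uniq_leq_size//.
  by move=> x; rewrite in_fset_set// inE => /Xs.
case: asboolP => // fX; rewrite lee_fin => Xc.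
exists (finmap.enum_fset (fset_set X)) => // x Xx /=.
by rewrite in_fset_set// inE.
Qed.

Lemma intcv_inj (R : realType) (n : nat) : injective (@intcv R n).
Proof.
move=> x y /colP xy; apply/colP => i.
by have := xy i; rewrite !mxE => /intr_inj.
Qed.

Lemma intcvD (R : realType) (n : nat) (x y : 'cV[int]_n) :
  intcv R (x + y) = intcv R x + intcv R y.
Proof. by apply/colP => i; rewrite !mxE intrD. Qed.

Lemma intcvB (R : realType) (n : nat) (x y : 'cV[int]_n) :
  intcv R (x - y) = intcv R x - intcv R y.
Proof. by apply/colP => i; rewrite !mxE intrB. Qed.

(** States that the uniform upper density at radius [r] is at most [c], for integer points and
    without extended reals: (2 r)^n is the volume of the ball. *)
Definition density_le (R : realType) (n : nat) (E : set 'cV[int]_n) (r c : R) :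
    Prop :=
  forall x : 'cV[R]_n,
    at_most (E `&` [set z | ball x r (intcv R z)]) (c * (2 * r) ^+ n).

(** The gap between [c] and [d] is there because bounding every ball bounds the supremum only in the
    wide sense. *)
Lemma uniform_upper_density_lt (R : realType) (n : nat) (E : set 'cV[int]_n)
    (r c d : R) : 0 < r -> c < d -> density_le E r c ->
  (uniform_upper_density r (intcv R @` E) < d%:E)%E.
Proof.
move=> r0 cd Ec; apply: (@le_lt_trans _ _ c%:E); last by rewrite lte_fin.
apply: ge_ereal_sup => _ [x _ <-].
have v0 : 0 < ball_volume n r by rewrite ball_volumeE// exprn_gt0// mulr_gt0.
rewrite inver gt_eqF// lee_pdivrMr// -EFinM ball_volumeE//.
apply/at_mostP; apply: at_mostW (at_most_image (intcv R) (Ec x)) => //.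
by move=> _ [[z Ez <-] zx]; exists z.
Qed.

(** [F] may have non-integer points: it will be a symmetric difference with a translate by a real
    vector. *)
Lemma density_le_uniform (R : realType) (n : nat) (E : set 'cV[int]_n)
    (r d : R) (F : set 'cV[R]_n) : 0 < r -> intcv R @` E `<=` F ->
  (uniform_upper_density r F < d%:E)%E -> density_le E r d.
Proof.
move=> r0 EF Fd x; apply: (@at_most_preimage _ _ _ (intcv R)).
  exact: intcv_inj.
apply: (@at_mostW _ _ _ (F `&` ball x r)) (lexx _) _.
  by move=> _ [z [Ez zx] <-]; split => //; apply: EF; exists z.
apply/at_mostP.
have v0 : 0 < ball_volume n r by rewrite ball_volumeE// exprn_gt0// mulr_gt0.
rewrite -ball_volumeE// EFinM -lee_pdivrMr//.
apply: le_trans (ltW Fd); apply: ereal_sup_ubound; exists x => //.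
by rewrite inver gt_eqF.
Qed.

Lemma density_leW (R : realType) (n : nat) (E F : set 'cV[int]_n) (r c d : R) :
  0 <= r -> E `<=` F -> c <= d -> density_le F r c -> density_le E r d.
Proof.
move=> r0 EF cd Fc x; apply: at_mostW (Fc x) => [z [/EF//]|].
by rewrite ler_wpM2r// exprn_ge0// mulr_ge0.
Qed.

Lemma density_le0 (R : realType) (n : nat) (r c : R) :
  0 <= r -> 0 <= c -> density_le (set0 : set 'cV[int]_n) r c.
Proof.
move=> r0 c0 x; rewrite set0I; apply: at_most0.
by rewrite mulr_ge0// exprn_ge0// mulr_ge0.
Qed.

Lemma density_leU (R : realType) (n : nat) (E F : set 'cV[int]_n) (r c d : R) :
  density_le E r c -> density_le F r d -> density_le (E `|` F) r (c + d).
Proof.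
by move=> Ec Fd x; rewrite setIUl mulrDl; exact: at_mostU.
Qed.

Lemma density_le_shift (R : realType) (n : nat) (E : set 'cV[int]_n)
    (u : 'cV[int]_n) (r c : R) :
  density_le E r c -> density_le [set x | E (x + u)] r c.
Proof.
move=> Ec x.
apply: (at_mostW _ (lexx _)) (at_most_image (fun z => z - u)
  (Ec (x + intcv R u))).
move=> z [/= Ez /ball_cVP[r0 zx]]; exists (z + u); last by rewrite addrK.
split=> //; apply/ball_cVP; split=> // i.
by have := zx i; rewrite !mxE intrD opprD addrACA subrr addr0.
Qed.

Lemma density_le_exists (R : realType) (n k : nat)
    (E : 'I_k -> set 'cV[int]_n) (r c : R) : 0 <= r ->
  (forall i, density_le (E i) r c) ->
  density_le [set x | exists i, E i x] r (k%:R * c).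
Proof.
move=> r0; elim: k E => [|k IH] E Ec.
  rewrite mul0r; apply: (@density_leW _ _ _ set0 _ 0 0) => //;
    last exact: density_le0.
  by move=> x [[]].
apply: (density_leW r0 _ _
  (density_leU (Ec ord0) (IH _ (fun i => Ec (lift ord0 i))))).
  move=> x [i]; case: (unliftP ord0 i) => [j ->|->] Ex; last by left.
  by right; exists j.
by rewrite -natr1 mulrDl mul1r addrC.
Qed.

(* Locate a point of [E] in the ball by its offset from a corner, the offset in
   the direction [j] being divided by [K]: this loses no point. *)
Lemma density_le_sparse_line (R : realType) (n : nat) (E : set 'cV[int]_n)
    (j : 'I_n) (K : nat) (r : R) : (0 < K)%N -> K%:R <= r ->
  (forall x y, E x -> E y -> (forall i, i != j -> x i ord0 = y i ord0) ->
    x j ord0 < y j ord0 -> K%:Z <= y j ord0 - x j ord0) ->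
  density_le E r (2 ^+ n / K%:R).
Proof.
case: n E j => [E []//|n] E j K0 Kr sparse c.
have r1 : 1 <= r by apply: le_trans Kr; rewrite ler1n.
have f0 : 0 <= Num.floor (2 * r) by rewrite floor_ge0; lra.
pose lo i := Num.floor (c i ord0 - r).
(* Offsets from [lo] are integers below 2 r + 1, since rounding the corner down costs less than 1;
   hence they are at most [M]. *)
pose M := `|Num.floor (2 * r)|%N.+1.
pose M' := (M %/ K)%N.
have ME : M%:Z = Num.floor (2 * r) + 1 by rewrite intS gez0_abs// addrC.
have /andP[m1 m2] := floor_itv (2 * r).
have Mr : M%:R <= 2 * r + 1.
  by rewrite -[M%:R]/((Posz M)%:~R) ME intrD lerD2r.
pose k (x : 'cV[int]_n.+1) i := `|x i ord0 - lo i|%N.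
have inball x : ball c r (intcv R x) ->
    forall i, (k x i <= M)%N /\ x i ord0 = lo i + (k x i)%:Z.
  move=> /ball_cVP[_ xr] i; have := xr i; rewrite mxE ltr_norml => /andP[h1 h2].
  have /andP[l1 l2] := floor_itv (c i ord0 - r).
  rewrite intrD in l2.
  have lox : lo i <= x i ord0.
    by rewrite -ltzD1 -(ltr_int R) intrD /lo; lra.
  have kE : (k x i)%:Z = x i ord0 - lo i by rewrite /k gez0_abs// subr_ge0.
  split; last by rewrite kE addrC subrK.
  rewrite -lez_nat kE ME -ltzD1 -(ltr_int R) !intrD intrN /lo.
  by rewrite intrD in m2; lra.
pose f x : 'I_M'.+1 * {ffun 'I_n -> 'I_M.+1} :=
  (inord (k x j %/ K), [ffun i => inord (k x (lift j i))]).
have cardf : #|{: 'I_M'.+1 * {ffun 'I_n -> 'I_M.+1}}| = (M'.+1 * M.+1 ^ n)%N.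
  by rewrite card_prod card_ffun !card_ord.
(* Multiplied by [K], the left side is at most K + M, and K + M <= r + (2 r + 1) <= 4 r. *)
have M'r : M'.+1%:R <= 4 * r / K%:R.
  rewrite ler_pdivlMr ?ltr0n// -natrM mulSn natrD.
  have : (M' * K)%:R <= M%:R :> R by rewrite ler_nat leq_trunc_div.
  by lra.
apply: (@at_mostW _ _ _ _ (#|{: 'I_M'.+1 * {ffun 'I_n -> 'I_M.+1}}|)%:R _
  (fun _ h => h)).
  rewrite cardf natrM natrX.
  have -> : 2 ^+ n.+1 / K%:R * (2 * r) ^+ n.+1 =
      4 * r / K%:R * (4 * r) ^+ n.
    rewrite mulrAC -exprMn mulrA exprS [RHS]mulrAC.
    by rewrite (_ : 2 * 2 = 4)// -natrM.
  apply: ler_pM => //.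
  by apply: lerXn2r; rewrite ?nnegrE//; [lra|rewrite -natr1; lra].
rewrite cardE; apply: (@at_most_inj _ _ _ f) => [|*]; last by rewrite mem_enum.
move=> x y [Ex xr] [Ey yr] [/eqP fj /ffunP fi].
have xb := inball _ xr; have yb := inball _ yr.
have E' i : i != j -> x i ord0 = y i ord0.
  case: (unliftP j i) => [i' -> _|-> /eqP//].
  have := fi i'; rewrite !ffunE => /(congr1 val) /=.
  rewrite !inordK ?ltnS ?(xb _).1 ?(yb _).1// => kE.
  by rewrite (xb _).2 (yb _).2 kE.
have lek z : ball c r (intcv R z) -> (k z j %/ K < M'.+1)%N.
  by move=> /inball zb; rewrite ltnS leq_div2r// (zb _).1.
(* Equal quotients by [K] mean a difference less than [K], which sparseness excludes for distinct
   points on a line. *)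
have nlt u v : ball c r (intcv R u) -> ball c r (intcv R v) ->
    (k u j %/ K = k v j %/ K)%N -> (v j ord0 - u j ord0 < K%:Z)%R.
  move=> /inball ub /inball vb uv; rewrite (ub _).2 (vb _).2.
  rewrite opprD addrACA subrr add0r ltrBlDl -PoszD ltz_nat.
  by rewrite {1}(divn_eq (k v j) K) -uv {2}(divn_eq (k u j) K) -addnA ltn_add2l
    ltn_addl// ltn_mod.
have kj : (k x j %/ K = k y j %/ K)%N.
  by move/eqP: fj => /(congr1 val) /=; rewrite !inordK ?lek.
apply/colP => i; have [->|/E'//] := eqVneq i j.
have [xy|yx|//] := ltgtP (x j ord0) (y j ord0).
  by have := sparse x y Ex Ey E' xy; rewrite leNgt nlt.
have := sparse y x Ey Ex (fun i ij => esym (E' i ij)) yx.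
by rewrite leNgt nlt.
Qed.

(** * Flips of the rounding under small perturbations *)

Lemma roundDz (R : realType) (s : R) (w : int) :
  round (s + w%:~R) = round s + w.
Proof.
apply/roundP; have /roundP/andP[h1 h2] := erefl (round s).
by rewrite intrD; apply/andP; split; lra.
Qed.

Lemma round_itv (R : realType) (s : R) :
  (round s)%:~R - 2^-1 < s <= (round s)%:~R + 2^-1.
Proof. exact/roundP. Qed.

(** Rounding jumps only at half-integers, so one of them separates [s] from [s + t]. *)
Lemma round_flip (R : realType) (s t d : R) : `|t| < d ->
  round (s + t) <> round s -> exists p : int, `|s - (p%:~R + 2^-1)| <= d.
Proof.
rewrite ltr_norml => /andP[t1 t2] flip.
have /andP[h1 h2] := round_itv s.
have [lt|ge] := ltrP ((round s)%:~R + 2^-1) (s + t).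
  by exists (round s); rewrite ler_norml; apply/andP; split; lra.
have [lt'|ge'] := ltrP ((round s)%:~R - 2^-1) (s + t).
  by exfalso; apply: flip; apply/roundP; rewrite lt' ge.
exists (round s - 1); rewrite intrB ler_norml; apply/andP; split; lra.
Qed.

(** Finitely many non-integers stay away from the integers. The factor 2 serves a pair of flipped
    points, each within [d] of a half-integer. *)
Lemma irrational_gap (R : realType) (a : R) (K : nat) :
  (forall q, (0 < q)%N -> q%:R * a \isn't a Num.int) ->
  exists2 d : R, 0 < d &
    forall q (p : int), (0 < q < K)%N -> 2 * d < `|q%:R * a - p%:~R|.
Proof.
move=> irr; elim: K => [|K [d d0 IH]].
  by exists 1 => // q p; rewrite ltn0 andbF.
have [->|K0] := posnP K.
  by exists 1 => // q p; rewrite ltnS leqn0; case: q.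
set y := K%:R * a; set g := `|y - (round y)%:~R|.
have g0 : 0 < g.
  rewrite normr_gt0 subr_eq0; apply: contraNneq (irr _ K0) => yE.
  by rewrite -/y yE intr_int.
(* The bound g / 4 handles the integer nearest to [y]; any other is at distance at least 1/2, which
   1/8 handles. *)
exists (Num.min d (Num.min (g / 4) (8^-1))).
  by rewrite !lt_min d0 divr_gt0//= invr_gt0.
set d' := Num.min _ _.
have [dd [dg d8]] : d' <= d /\ d' <= g / 4 /\ d' <= 8^-1.
  by rewrite /d' !ge_min !lexx ?orbT.
move=> q p /andP[q0]; rewrite ltnS leq_eqVlt => /orP[/eqP ->|qK]; last first.
  by apply: le_lt_trans (IH q p _); [lra|rewrite q0].
rewrite -/y; have [->|pr] := eqVneq p (round y); first by rewrite -/g; lra.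
have /andP[h1 h2] := round_itv y.
have [lt|lt|eq] := ltgtP p (round y); last by rewrite eq eqxx in pr.
  have : p%:~R + 1 <= (round y)%:~R :> R by rewrite -intrD1 ler_int lezD1.
  by move=> ?; rewrite ger0_norm; lra.
have : (round y)%:~R + 1 <= p%:~R :> R by rewrite -intrD1 ler_int lezD1.
by move=> ?; rewrite ler0_norm; lra.
Qed.

Lemma mulmx_cvE (R : realType) (n : nat) (A : 'M[R]_n) (x : 'cV[R]_n) i :
  (A *m x) i ord0 = \sum_j A i j * x j ord0.
Proof. by rewrite mxE. Qed.

Definition round_flips (R : realType) (n : nat) (A : 'M[R]_n) (i : 'I_n)
    (t : R) : set 'cV[int]_n :=
  [set x | round ((A *m intcv R x) i ord0 + t) <>
           round ((A *m intcv R x) i ord0)].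

(* If a row of [A] is rational, the admissible [t] vanish once they are small;
   otherwise the flipped points are sparse along a coordinate with an
   irrational coefficient. *)
Lemma round_flip_density (R : realType) (n : nat) (A : 'M[R]_n) (i : 'I_n)
    (e : R) : 0 < e ->
  exists d : R, 0 < d /\ exists rho : R, 0 < rho /\
    forall t, `|t| < d ->
      (exists v w, t = (A *m intcv R v - intcv R w) i ord0) ->
    forall r, rho <= r -> density_le (round_flips A i t) r e.
Proof.
move=> e0.
have [rat|] := pselect (forall j, exists q, (0 < q)%N /\
    q%:R * A i j \is a Num.int).
  have [q qP] := choice rat.
  (* A common denominator of row [i]: the admissible [t] are multiples of 1 / Q, so those smaller
     than 1 / Q vanish. *)
  pose Q := (\prod_j q j)%N.
  have Q0 : (0 < Q)%N by rewrite prodn_gt0// => j; case: (qP j).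
  have Qint j : Q%:R * A i j \is a Num.int.
    rewrite /Q (bigD1 j)//= mulnC natrM -mulrA rpredM//; last by case: (qP j).
    exact: natr_int.
  exists (Q%:R^-1); split; first by rewrite invr_gt0 ltr0n.
  exists 1; split=> // t tQ [v [w tE]] r r1.
  have r0 : 0 <= r by lra.
  suff t0 : t = 0.
    apply: (@density_leW _ _ _ set0 _ 0 _) => //; last exact: density_le0.
      by rewrite t0 => x; rewrite /round_flips/= addr0.
    exact: ltW.
  have Qt : Q%:R * t \is a Num.int.
    rewrite tE mxE mulmx_cvE mxE mulrDr mxE rpredD//.
      rewrite mulr_sumr rpred_sum// => j _; rewrite mulrA rpredM//.
      by rewrite mxE intr_int.
    by rewrite mulrN rpredN rpredM ?natr_int ?intr_int.
  have [/eqP|Qt0] := eqVneq (Q%:R * t) 0.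
    by rewrite mulf_eq0 pnatr_eq0 gtn_eqF//= => /eqP.
  have := norm_intr_ge1 Qt Qt0; rewrite normrM ger0_norm// leNgt.
  by rewrite -ltr_pdivlMl ?ltr0n// mulr1 tQ.
move=> /existsNP[j /forallNP irr].
have {}irr q : (0 < q)%N -> q%:R * A i j \isn't a Num.int.
  by move=> q0; apply/negP => qA; apply: (irr q).
(* Chosen so that the density 2^n / K of a [K]-sparse set is at most [e]. *)
pose K := (Num.bound (2 ^+ n / e)).+1.
have [d d0 gap] := irrational_gap K irr.
exists d; split=> //; exists K%:R; split=> [|t]; first by rewrite ltr0n.
move=> td _ r Kr.
have Ke : 2 ^+ n / K%:R <= e.
  rewrite ler_pdivrMr ?ltr0n// mulrC -ler_pdivrMr//.
  apply: le_trans (ltW (archi_boundP _)) _; last by rewrite ler_nat.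
  by rewrite divr_ge0 ?exprn_ge0// ltW.
apply: (@density_leW _ _ _ _ _ _ _ _ (fun _ h => h) Ke).
  exact: le_trans Kr.
apply: (density_le_sparse_line (j := j)) => //.
(* Two flipped points at distance k < K along direction [j] would put k times the irrational
   coefficient within 2 d of the integer p' - p. *)
move=> x y /= /(round_flip td)[p Hp] /(round_flip td)[p' Hp'] xy ltxy.
rewrite leNgt; apply/negP => ltK.
pose k := `|y j ord0 - x j ord0|%N.
have kE : k%:Z = y j ord0 - x j ord0 by rewrite gez0_abs// subr_ge0 ltW.
have kK : (0 < k < K)%N by rewrite -!ltz_nat kE subr_gt0 ltxy.
have := gap k (p' - p) kK; rewrite ltNge => /negP; apply.
have AE : (A *m intcv R y) i ord0 - (A *m intcv R x) i ord0 = k%:R * A i j.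
  rewrite !mulmx_cvE -sumrB (bigD1 j)//= big1 ?addr0.
    by rewrite -mulrBr !mxE -intrB -kE mulrC.
  by move=> l lj; rewrite !mxE xy// subrr.
rewrite -AE intrB.
move: Hp Hp'; rewrite !ler_norml => /andP[? ?] /andP[? ?].
by apply/andP; split; lra.
Qed.

(** * Relative density and bounds for linear maps *)

(** A form with a single radius and closed cubes; enlarging the radius by 1 recovers open balls. *)
Lemma relatively_denseP (R : realType) (n : nat) (G : set 'cV[R]_n) :
  relatively_dense G <->
  exists2 L : R, 0 < L & forall x : 'cV[R]_n,
    exists2 y, G y & forall i, `|x i ord0 - y i ord0| <= L.
Proof.
split=> [[L L0 GL]|[L L0 GL]].
  exists L => // x; have [y [Gy /ball_cVP[_ xy]]] := GL x L (lexx _).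
  by exists y => // i; exact: ltW.
exists (L + 1) => [|x r Lr]; first by rewrite addr_gt0.
have [y Gy xy] := GL x; exists y; split=> //; apply/ball_cVP.
by split=> [|i]; [lra|apply: le_lt_trans (xy i) _; lra].
Qed.

Lemma relatively_denseS (R : realType) (n : nat) (G H : set 'cV[R]_n) :
  G `<=` H -> relatively_dense G -> relatively_dense H.
Proof.
move=> GH [L L0 GL]; exists L => // x r /GL-/(_ x)[y [Gy xy]].
by exists y; split=> //; exact: GH.
Qed.

Lemma round_near (R : realType) (s : R) : `|s - (round s)%:~R| <= 2^-1.
Proof.
have /andP[h1 h2] := round_itv s.
by rewrite ler_norml; apply/andP; split; lra.
Qed.

Lemma relatively_dense_int (R : realType) (n : nat) :
  relatively_dense (range (@intcv R n)).
Proof.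
apply/relatively_denseP; exists 1 => // x.
exists (intcv R (map_mx (@round R) x)) => [|i].
  by exists (map_mx (@round R) x).
by rewrite !mxE; apply: le_trans (round_near _) _; lra.
Qed.

(** The sum of the absolute values of all entries bounds the operator norm for the sup norm; adding
    1 ensures [1 <= C]. *)
Lemma mulmx_bounded (R : realType) (n : nat) (A : 'M[R]_n) :
  exists2 C : R, 1 <= C & forall (x : 'cV[R]_n) c,
    (forall j, `|x j ord0| <= c) -> forall i, `|(A *m x) i ord0| <= C * c.
Proof.
pose S i := \sum_j `|A i j|.
have S0 i : 0 <= S i by apply: sumr_ge0.
exists (1 + \sum_i S i) => [|x c xc i]; first by rewrite lerDl sumr_ge0.
have c0 : 0 <= c by apply: le_trans (xc i).
rewrite mulmx_cvE; apply: le_trans (ler_norm_sum _ _ _) _.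
apply: (@le_trans _ _ (S i * c)).
  by rewrite mulr_suml; apply: ler_sum => j _; rewrite normrM ler_wpM2l.
rewrite ler_wpM2r// (bigD1 i)//= addrCA lerDl addr_ge0//.
by apply: sumr_ge0 => k _; exact: S0.
Qed.

(** * Integer almost periods *)

Definition shift_diff (n : nat) (G : set 'cV[int]_n) (u : 'cV[int]_n) :
  set 'cV[int]_n := [set x | G (x - u) /\ ~ G x \/ G x /\ ~ G (x - u)].

Definition integer_periods (R : realType) (n : nat) (G : set 'cV[int]_n)
    (e rho : R) : set 'cV[int]_n :=
  [set u | forall r, rho <= r -> density_le (shift_diff G u) r e].

Lemma shift_diff_image (R : realType) (n : nat) (G : set 'cV[int]_n)
    (u : 'cV[int]_n) :
  translate (intcv R @` G) (intcv R u) `+` intcv R @` G =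
  intcv R @` shift_diff G u.
Proof.
have imG x : (intcv R @` G) (intcv R x) <-> G x.
  by split=> [[y Gy /intcv_inj <-]|Gx] //; exists x.
have trG x : translate (intcv R @` G) (intcv R u) (intcv R x) <-> G (x - u).
  split=> [[_ [y Gy <-]]|Gx].
    by rewrite -intcvD => /intcv_inj <-; rewrite addrK.
  exists (intcv R (x - u)); first by exists (x - u).
  by rewrite -intcvD subrK.
apply/seteqP; split=> [x|_ [x [[Gx nGx]|[Gx nGx]] <-]].
- case=> -[].
    move=> [_ [y Gy <-] <-]; rewrite -intcvD => nG; exists (y + u) => //.
    by left; rewrite addrK; split=> // /imG.
  by move=> [y Gy <-] nG; exists y => //; right; split=> // /trG.
- by left; split; [exact/trG|move=> /imG].
- by right; split; [exact/imG|move=> /trG].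
Qed.

(* A translation by a non-integer vector makes [G + v] and [G] disjoint; it can
   only be an almost period if [G] itself has small density. *)
Lemma integer_periods_relatively_dense (R : realType) (n : nat)
    (G : set 'cV[int]_n) (e : R) : 0 < e ->
  almost_periodic_pattern (intcv R @` G) ->
  exists2 rho : R, 0 < rho &
    relatively_dense (intcv R @` integer_periods G e rho).
Proof.
move=> e0 [_ /(_ (e / 2))[]]; first lra.
move=> rho rho0 dense; exists rho => //.
have [vint|] := pselect (forall v, (forall r, rho <= r ->
    (uniform_upper_density r (translate (intcv R @` G) v `+` (intcv R @` G))
      < (e / 2)%:E)%E) -> range (@intcv R n) v).
  apply: relatively_denseS dense => v vP; have [u _ uv] := vint v vP.
  exists u => // r rr; have r0 : 0 < r by lra.
  apply: (@density_leW _ _ _ _ r (e / 2) e (ltW r0) (fun _ h => h)); first lra.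
  apply: density_le_uniform (vP r rr) => //.
  by rewrite -uv shift_diff_image.
move=> /existsNP[v /not_implyP[vP vnint]].
have Ge r : rho <= r -> density_le G r (e / 2).
  move=> rr; apply: density_le_uniform (vP r rr); first lra.
  move=> x Gx; right; split=> // -[_ [y Gy <-] yv]; apply: vnint.
  case: Gx => z Gz zx; exists (z - y) => //.
  by rewrite intcvB zx -yv addrC addKr.
(* With [G] this sparse every integer vector is a period: the symmetric difference lies in the union
   of [G] and a translate, each of density at most e / 2. *)
apply: relatively_denseS (@relatively_dense_int R n) => _ [u _ <-].
exists u => // r rr; have r0 : 0 < r by lra.
apply: (@density_leW _ _ _ _ r (e / 2 + e / 2) e (ltW r0)); last first.
- exact: density_leU (Ge r rr) (density_le_shift (- u) (Ge r rr)).
- lra.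
- by move=> x [[? _]|[? _]]; [right|left].
Qed.

(** With y = x + u', the points to compare are y - u and y - u'; membership of each in [G] is
    compared with that of y. *)
Lemma integer_periodsB (R : realType) (n : nat) (G : set 'cV[int]_n)
    (e rho : R) (u u' : 'cV[int]_n) : 0 < rho ->
  integer_periods G e rho u -> integer_periods G e rho u' ->
  integer_periods G (e + e) rho (u - u').
Proof.
move=> rho0 Pu Pu' r rr; have r0 : 0 < r by lra.
apply: (@density_leW _ _ _ _ r _ _ (ltW r0) _ (lexx _)
  (density_le_shift u' (density_leU (Pu r rr) (Pu' r rr)))).
move=> x; rewrite /shift_diff/= addrK opprB addrA => h.
have [Gxu|Gxu] := pselect (G (x + u')).
  by case: h => -[h1 h2]; [right; right|left; right].
by case: h => -[h1 h2]; [left; left|right; left].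
Qed.

(* Pigeonhole on the class of [A u] modulo [Z^n]: differences of two vectors of
   [N] in the same cell are nearly mapped into [Z^n]. *)
Lemma near_integer_differences (R : realType) (n : nat) (A : 'M[R]_n)
    (N : set 'cV[int]_n) (d : R) : A \in unitmx -> 0 < d ->
  relatively_dense (intcv R @` N) ->
  relatively_dense (intcv R @` [set w | exists u u', [/\ N u, N u' &
    forall i, `|(A *m intcv R (u - u') - intcv R w) i ord0| < d]]).
Proof.
move=> uA d0 /relatively_denseP[L L0 NL].
(* The cells have side 1 / (M + 1), less than [d]. *)
pose M := Num.bound d^-1.
have Md : M.+1%:R^-1 < d.
  rewrite invf_plt ?posrE//; apply: lt_trans (archi_boundP _) _.
    by rewrite invr_ge0 ltW.
  by rewrite ltr_nat.
pose fl (u : 'cV[int]_n) i := Num.floor ((A *m intcv R u) i ord0).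
pose fr u i := (A *m intcv R u) i ord0 - (fl u i)%:~R.
have frP u i : 0 <= fr u i < 1.
  have /andP[h1 h2] := floor_itv ((A *m intcv R u) i ord0).
  by rewrite /fr/fl; rewrite intrD in h2; apply/andP; split; lra.
pose cl u : {ffun 'I_n -> 'I_M.+1} :=
  [ffun i => inord `|Num.floor (M.+1%:R * fr u i)|%N].
have clP u i : (cl u i)%:R <= M.+1%:R * fr u i < (cl u i)%:R + 1.
  have /andP[f0 f1] := frP u i.
  have /andP[h1 h2] := floor_itv (M.+1%:R * fr u i).
  have fl0 : 0 <= Num.floor (M.+1%:R * fr u i) by rewrite floor_ge0 mulr_ge0.
  have -> : (cl u i)%:R = (Num.floor (M.+1%:R * fr u i))%:~R :> R.
    rewrite /cl ffunE inordK; first by rewrite -[LHS]/((Posz _)%:~R) gez0_abs.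
    rewrite -ltz_nat gez0_abs// -(ltr_int R); apply: le_lt_trans h1 _.
    by rewrite gtr_pMr.
  by rewrite h1 -intrD1.
have clE u v i : cl u = cl v -> `|fr u i - fr v i| < d.
  move=> uv; have /andP[h1 h2] := clP u i; have /andP[h3 h4] := clP v i.
  rewrite uv in h1 h2; apply: lt_trans Md.
  rewrite -(ltr_pM2l (x := M.+1%:R))// mulfV// -[X in X * _]ger0_norm//.
  by rewrite -normrM mulrBr ltr_norml; apply/andP; split; lra.
(* One element of [N] is fixed in each cell that [N] meets; the value 0 elsewhere is a mere
   default. *)
pose rep c := if pselect (exists u, N u /\ cl u = c) is left h
  then projT1 (cid h) else 0.
have repP u : N u -> N (rep (cl u)) /\ cl (rep (cl u)) = cl u.
  move=> Nu; rewrite /rep; case: pselect => [h|[]]; last by exists u.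
  by case: cid.
(* There are finitely many cells, so the representatives are uniformly bounded. *)
pose B : R := \sum_c \sum_i `|(rep c i ord0)%:~R|.
have repB c i : `|(rep c i ord0)%:~R| <= B.
  rewrite /B (bigD1 c)//= (bigD1 i)//= -addrA lerDl addr_ge0//.
    by apply: sumr_ge0.
  by apply: sumr_ge0 => c' _; apply: sumr_ge0.
have B0 : 0 <= B by apply: sumr_ge0 => c' _; apply: sumr_ge0.
have [C C1 AC] := mulmx_bounded A.
apply/relatively_denseP; exists (C * (L + B) + d).
  by rewrite addr_gt0// mulr_gt0 ?ltr_wpDr//; lra.
(* As [u] is within [L] of the preimage of [y] and [u'] is bounded by [B], the vector A (u - u') is
   within C (L + B) of [y]; passing to [w] costs [d]. *)
move=> y; have [_ [u Nu <-] uL] := NL (invmx A *m y).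
have [Nr clr] := repP u Nu; set u' := rep (cl u) in Nr clr.
(* Subtracting the integer parts leaves the difference of two fractional parts in the same cell. *)
pose w : 'cV[int]_n := \col_i (fl u i - fl u' i).
have wd i : `|(A *m intcv R (u - u') - intcv R w) i ord0| < d.
  rewrite intcvB mulmxBr !mxE.
  have := clE _ _ i (esym clr); rewrite /fr !mxE intrB.
  by congr (`|_| < _); lra.
exists (intcv R w); first by exists w => //; exists u, u'.
move=> i; have -> : y i ord0 - intcv R w i ord0 =
    (A *m (invmx A *m y - intcv R (u - u'))) i ord0 +
    (A *m intcv R (u - u') - intcv R w) i ord0.
  by rewrite mulmxBr mulKVmx// !mxE; lra.
apply: le_trans (ler_normD _ _) _; apply: lerD (ltW (wd i)).
apply: AC => j; rewrite intcvB opprB addrCA addrC.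
rewrite [X in `|X|]mxE; apply: le_trans (ler_normD _ _) _; apply: lerD.
  by have := uL j; rewrite !mxE.
by rewrite mxE; exact: repB.
Qed.

(** * Discretization of Delone sets and almost periodic patterns *)

Lemma discretization_near (R : realType) (n : nat) (A : 'M[R]_n)
    (x : 'cV[int]_n) i :
  `|(A *m intcv R x) i ord0 - intcv R (discretization A x) i ord0| <= 2^-1.
Proof. by rewrite !mxE; exact: round_near. Qed.

(** Uniform discreteness holds because the image is integral. For relative density, a point of [G]
    near the preimage of [y] is mapped near [y], and rounding moves it by at most 1/2. *)
Lemma delone_discretization (R : realType) (n : nat) (A : 'M[R]_n)
    (G : set 'cV[int]_n) : A \in unitmx -> delone (intcv R @` G) ->
  delone (intcv R @` (discretization A @` G)).
Proof.
move=> uA [/relatively_denseP[L L0 GL] _]; split; last first.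
  exists 2^-1 => [|x r r0 r2]; first by rewrite invr_gt0.
  move=> _ _ [[y _ <-] /ball_cVP[_ yr]] [[z _ <-] /ball_cVP[_ zr]].
  (* Coordinates of two points in a ball of radius at most 1/2 are integers differing by less than
     1. *)
  congr intcv; apply/colP => i; apply/eqP; rewrite -subr_eq0 -absz_eq0.
  rewrite -leqn0 -ltnS -ltz_nat -(ltr_int R) -[X in X < _]/(_%:~R) abszE.
  rewrite intr_norm intrB.
  have := yr i; have := zr i; rewrite !mxE !ltr_norml.
  by move=> /andP[? ?] /andP[? ?]; apply/andP; split; lra.
have [C C1 AC] := mulmx_bounded A.
apply/relatively_denseP; exists (C * L + 1) => [|y].
  by rewrite addr_gt0// mulr_gt0//; lra.
have [_ [x Gx <-] xL] := GL (invmx A *m y).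
exists (intcv R (discretization A x)) => [|i].
  by exists (discretization A x) => //; exists x.
have -> : y i ord0 - intcv R (discretization A x) i ord0 =
    (A *m (invmx A *m y - intcv R x)) i ord0 +
    ((A *m intcv R x) i ord0 - intcv R (discretization A x) i ord0).
  by rewrite mulmxBr mulKVmx// !mxE; lra.
apply: le_trans (ler_normD _ _) _; apply: lerD.
  by apply: AC => j; have := xL j; rewrite !mxE.
by apply: le_trans (discretization_near _ _ _) _; lra.
Qed.

(** A (x + v) is A x plus the small error A v - w plus the integer vector [w], which commutes with
    rounding. *)
Lemma discretizationD (R : realType) (n : nat) (A : 'M[R]_n)
    (x v w : 'cV[int]_n) :
  (forall i, round ((A *m intcv R x) i ord0 +
                    (A *m intcv R v - intcv R w) i ord0) =
             round ((A *m intcv R x) i ord0)) ->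
  discretization A (x + v) = discretization A x + w.
Proof.
move=> H; apply/colP => i; rewrite mxE [RHS]mxE [in RHS]mxE -H -roundDz.
by congr round; rewrite intcvD mulmxDr !mxE; lra.
Qed.

(* A point of the symmetric difference for the image comes from a point of the
   one for [G] or from a point where the rounding flips, and these lie in a ball
   of comparable radius because [A] is invertible. *)
Lemma density_le_shift_diff_discretization (R : realType) (n : nat)
    (A : 'M[R]_n) : A \in unitmx ->
  exists2 C : R, 1 <= C &
    forall (G : set 'cV[int]_n) (v w : 'cV[int]_n) (r c : R),
    1 <= r -> 0 <= c ->
    (forall i, `|(A *m intcv R v - intcv R w) i ord0| <= 2^-1) ->
    density_le (shift_diff G v `|` [set x | exists i,
      round_flips A i ((A *m intcv R v - intcv R w) i ord0) (x - v)])
      (C * (r + 2)) c ->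
    density_le (shift_diff (discretization A @` G) w) r (2 * c * (3 * C) ^+ n).
Proof.
move=> uA; have [C C1 AC] := mulmx_bounded (invmx A).
exists C => // G v w r c r1 c0 vw; set Z := _ `|` _ => Zc y.
have {}Zc := Zc (invmx A *m y).
(* [Z] is used twice, once for points of the image and once for points of its translate by [w];
   hence the factor 2. *)
apply: (at_mostW _ _ (at_mostU (at_most_image (discretization A) Zc)
  (at_most_image (fun x => discretization A (x - v) + w) Zc))); last first.
  (* This uses r + 2 <= 3 r. *)
  have le3 : (2 * (C * (r + 2))) ^+ n <= (3 * C) ^+ n * (2 * r) ^+ n.
    by rewrite -exprMn; apply: lerXn2r; rewrite ?nnegrE; nra.
  by have := ler_wpM2l c0 le3; lra.
(* A x is within r + 1 of [y], so x is within C (r + 1) of its preimage; the larger radius gives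
   strictness. *)
have inball x z : ball y r (intcv R z) ->
    (forall i, `|(A *m intcv R x) i ord0 - intcv R z i ord0| <= 1) ->
    ball (invmx A *m y) (C * (r + 2)) (intcv R x).
  move=> /ball_cVP[_ yz] xz; apply/ball_cVP; split=> [|j]; first by nra.
  have -> : (invmx A *m y) j ord0 - intcv R x j ord0 =
      (invmx A *m (y - A *m intcv R x)) j ord0.
    by rewrite mulmxBr mulKmx// !mxE.
  apply: le_lt_trans (AC _ (r + 1) _ j) _; last by nra.
  move=> i; have := yz i; have := xz i; rewrite !mxE.
  rewrite ler_norml ltr_norml => /andP[? ?] /andP[? ?].
  by rewrite ler_norml; apply/andP; split; lra.
have near1 x i : `|(A *m intcv R x) i ord0 -
    intcv R (discretization A x) i ord0| <= 1.
  by apply: le_trans (discretization_near _ _ _) _; lra.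
(* The error is A v - w plus the rounding error at x - v, each at most 1/2. *)
have near2 x i : `|(A *m intcv R x) i ord0 -
    intcv R (discretization A (x - v) + w) i ord0| <= 1.
  have := discretization_near A (x - v) i; have := vw i.
  rewrite [intcv R (discretization _ _ + w)]intcvD intcvB mulmxBr.
  move: (A *m intcv R v) (A *m intcv R x) => Av Ax.
  rewrite [X in `|X| <= 1](_ : _ = (Av - intcv R w) i ord0 +
    ((Ax - Av) i ord0 - intcv R (discretization A (x - v)) i ord0)).
    move=> h1 h2; apply: le_trans (ler_normD _ _) _.
    by rewrite (splitr 1) !mul1r lerD.
  by rewrite !mxE; lra.
move=> z [[[[x' Gx' x'z] nGz]|[[x Gx xz] nGz]] yz].
(* Here [z] comes from the translate only. If x' + v lies in [G] and no coordinate flips at x', its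
   discretization is [z], a contradiction. *)
- have zE : z = discretization A ((x' + v) - v) + w by rewrite addrK x'z subrK.
  right; exists (x' + v) => //; split; last first.
    by apply: (inball _ z) => // i; rewrite [in X in _ - X]zE; exact: near2.
  have [Gx|nGx] := pselect (G (x' + v)); last by left; left; rewrite addrK.
  right => /=; apply: contrapT => /forallNP nflip; apply: nGz.
  exists (x' + v) => //; rewrite [RHS]zE addrK; apply: discretizationD => i.
  by have := nflip i; rewrite addrK => /contrapT.
(* Here [z] comes from the image only. If x - v lies in [G] and nothing flips there, [z] also
   belongs to the translate. *)
- left; exists x => //; split; last first.
    by apply: (inball _ z) => // i; rewrite -xz; exact: near1.
  have [Gx'|nGx'] := pselect (G (x - v)); last by left; right.
  right => /=; apply: contrapT => /forallNP nflip; apply: nGz.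
  exists (x - v) => //; rewrite -xz -[in RHS](subrK v x).
  rewrite (@discretizationD _ _ _ (x - v) v w) ?addrK//.
  by move=> i; have := nflip i => /contrapT.
Qed.

Lemma almost_periodic_pattern_discretization (R : realType) (n : nat)
    (A : 'M[R]_n) (G : set 'cV[int]_n) : A \in unitmx ->
  almost_periodic_pattern (intcv R @` G) ->
  almost_periodic_pattern (intcv R @` (discretization A @` G)).
Proof.
move=> uA apG; split; first exact: delone_discretization apG.1.
move=> e e0; have [C C1 AC] := density_le_shift_diff_discretization uA.
have Cn0 : 0 < (3 * C) ^+ n by rewrite exprn_gt0//; lra.
have [c c0 ce] : exists2 c, 0 < c & 2 * c * (3 * C) ^+ n < e.
  (* This makes the final density bound equal to e / 2. *)
  exists (e / (4 * (3 * C) ^+ n)); first by rewrite divr_gt0// mulr_gt0.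
  by rewrite invfM -!mulrA mulVf ?gt_eqF// mulr1; lra.
(* A difference of two periods doubles c / 4; the remaining c / 2 is shared among the flips of the
   [n] coordinates. *)
have c4 : 0 < c / 4 by rewrite divr_gt0.
have [rho rho0 dense] := integer_periods_relatively_dense c4 apG.
pose c' := c / 2 / n.+1%:R.
have c'0 : 0 < c' by rewrite /c' divr_gt0// divr_gt0.
have nc' : n%:R * c' <= c / 2.
  rewrite /c' mulrCA ler_piMr ?divr_ge0 ?(ltW c0)//.
  by rewrite ler_pdivrMr ?ltr0n// mul1r ler_nat.
have /choice[d dP] := fun i => round_flip_density A i c'0.
have d0 i : 0 < d i by case: (dP i).
have /choice[rho' rhoP] := fun i => (dP i).2.
have rho'0 i : 0 < rho' i by case: (rhoP i).
(* Inverting a sum of inverses gives a positive number below 1/2 and below every [d i]. *)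
pose delta := (2 + \sum_i (d i)^-1)^-1.
have sd0 : 0 <= \sum_i (d i)^-1 by apply: sumr_ge0 => i _; rewrite invr_ge0 ltW.
have delta0 : 0 < delta by rewrite invr_gt0; lra.
have delta2 : delta <= 2^-1 by rewrite lef_pV2 ?posrE; lra.
have deltad i : delta <= d i.
  rewrite -[d i]invrK lef_pV2 ?posrE ?invr_gt0//; last lra.
  rewrite (bigD1 i)//= addrCA lerDl addr_ge0//.
  by apply: sumr_ge0 => j _; rewrite invr_ge0 ltW.
pose re := 1 + rho + \sum_i rho' i.
have sr0 : 0 <= \sum_i rho' i by apply: sumr_ge0 => i _; exact: ltW.
have re_rho' i : rho' i <= re.
  have : rho' i <= \sum_i rho' i.
    by rewrite (bigD1 i)//= lerDl; apply: sumr_ge0 => j _; exact: ltW.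
  by rewrite /re; lra.
exists re; first by rewrite /re; lra.
apply: relatively_denseS (near_integer_differences uA delta0 dense).
move=> _ [w [u [u' [Pu Pu' uw]]] <-] r rer /=.
have r1 : 1 <= r by rewrite /re in rer; lra.
have Cr : r <= C * (r + 2) by nra.
rewrite shift_diff_image.
apply: (@uniform_upper_density_lt _ _ _ _ (2 * c * (3 * C) ^+ n)) => //.
  by lra.
apply: (AC _ (u - u')) => //; first exact: ltW.
  by move=> i; apply: le_trans (ltW (uw i)) _.
apply: (@density_leW _ _ _ _ _ (c / 4 + c / 4 + n%:R * c') _ _ (fun _ h => h)).
- by lra.
- by lra.
apply: density_leU.
  apply: (integer_periodsB rho0 Pu Pu').
  by apply: le_trans Cr; rewrite /re in rer; lra.
(* The flips are taken at x - v with v = u - u', hence the shift by the opposite vector. *)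
apply: (@density_le_shift _ _ [set x | exists i,
  round_flips A i ((A *m intcv R (u - u') - intcv R w) i ord0) x] (- (u - u'))).
apply: density_le_exists => [|i]; first by lra.
apply: (rhoP i).2; first exact: lt_le_trans (uw i) (deltad i).
  by exists (u - u'), w.
by apply: le_trans (re_rho' i) (le_trans rer Cr).
Qed.

Theorem theorem2 (R : realType) (n : nat) (hn : (1 <= n)%N) (A : 'M[R]_n)
  (hA : A \in unitmx) :
  (forall G : set 'cV[int]_n,
     almost_periodic_pattern (intcv R @` G) ->
     almost_periodic_pattern (intcv R @` (discretization A @` G))) /\
  (forall G : set 'cV[int]_n,
     is_model_set (intcv R @` G) ->
     is_model_set (intcv R @` (discretization A @` G))).
Proof.
split=> G; first exact: almost_periodic_pattern_discretization.
exact: model_set_discretization.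
Qed.
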